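(* Let $G_1$ be an $r_1$-regular graph with $n_1$ vertices and $m_1$ edges and let $G_2$ be an arbitrary graph with $n_2$ vertices. Then the Laplacian characteristic polynomial of the central edge neighborhood corona $G_1\underline{\boxdot}G_2$ is $$\begin{aligned}f(L(G_1\underline{\boxdot}G_2),x)=\;&(x-2)^{m_1-n_1}\Big[x^2-x(n_2r_1+r_1+2)\Big]\prod_{j=1}^{n_2}\big(x-1-\mu_j(G_2)\big)^{m_1}\\&\times\prod_{i=2}^{n_1}\Big[x^2-x\big(2+n_1+n_2r_1+\lambda_i(G_1)\big)+2n_1+n_2r_1-r_1+\lambda_i(G_1)-n_2\lambda_i(G_1)\Big].\end{aligned}$$
   Context: All graphs are simple and connected. For a graph $G$ on $n$ vertices, $A(G)$ is its adjacency matrix with eigenvalues $\lambda_1(G)\ge\dots\ge\lambda_n(G)$; $D(G)$ is the diagonal matrix of vertex degrees; $L(G)=D(G)-A(G)$ is the Laplacian matrix with eigenvalues $0=\mu_1(G)<\mu_2(G)\le\dots\le\mu_n(G)$. For an $n\times n$ matrix $M$, $f(M,x)=\det(xI_n-M)$, where $I_n$ is the identity matrix of order $n$. The central graph $C(G)$ of $G$ is obtained from $G$ by subdividing each edge of $G$ exactly once and joining all pairs of distinct vertices of $G$ that are nonadjacent in $G$; $\tilde V(G)=V(C(G))\setminus V(G)$ is the set of subdivision vertices, corresponding to the edges of $G$. The central edge neighborhood corona $G_1\underline{\boxdot}G_2$ is obtained by taking $C(G_1)$ and $|\tilde V(G_1)|$ copies of $G_2$, and joining the neighbors in $C(G_1)$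 of the $i$-th vertex of $\tilde V(G_1)$ to every vertex in the $i$-th copy of $G_2$, for each $i$.
   Formalization: The printed factor (x-1-μ_j(G_2))^{m_1} is corrected to (x-2-μ_j(G_2))^{m_1}; as printed the formula fails for G_1=K_2, G_2=K_1, where the corona is C_4 with Laplacian polynomial x(x-2)^2(x-4). *)

(* Defs.v *)
From mathcomp Require Import all_boot all_order all_algebra.
From mathcomp Require Import polyrcf.

Set Implicit Arguments.
Unset Strict Implicit.
Unset Printing Implicit Defensive.

Import Order.TTheory GRing.Theory Num.Theory.
Local Open Scope ring_scope.

Record sgraph := SGraph {
  vertex :> finType;
  adj : rel vertex;
  adj_sym : symmetric adj;
  adj_irrefl : irreflexive adj }.
Arguments adj {G} : rename.

Definition connected (G : sgraph) : Prop :=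
  (0 < #|G|)%N /\ forall u v : G, connect adj u v.

Definition degree (G : sgraph) (v : G) : nat := #|[set u : G | adj v u]|.

Definition regular (G : sgraph) (r : nat) : Prop :=
  forall v : G, degree v = r.

Definition edges (G : sgraph) : {set {set G}} :=
  [set [set p.1; p.2] | p in [set p : G * G | adj p.1 p.2]].

Definition edge (G : sgraph) : finType := {E : {set G} | E \in edges G}.

(* inl v is a vertex of G, inr E is the vertex subdividing the edge E. *)
Definition central_adj (G : sgraph) (a b : G + edge G) : bool :=
  match a, b with
  | inl u, inl v => (u != v) && ~~ adj u v
  | inl u, inr E => u \in val E
  | inr E, inl v => v \in val E
  | inr _, inr _ => false
  end.

Lemma central_adj_sym (G : sgraph) : symmetric (@central_adj G).
Proof. by move=> [u|E] [v|F] //=; rewrite eq_sym (@adj_sym G). Qed.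

Lemma central_adj_irrefl (G : sgraph) : irreflexive (@central_adj G).
Proof. by move=> [u|E] //=; rewrite eqxx. Qed.

Definition central (G : sgraph) : sgraph :=
  SGraph (@central_adj_sym G) (@central_adj_irrefl G).

(* inr (E, w) is the vertex w in the copy of G2 attached to the edge E. *)
Definition cen_corona_adj (G1 G2 : sgraph)
    (a b : central G1 + edge G1 * G2) : bool :=
  match a, b with
  | inl c, inl d => adj c d
  | inl c, inr (E, _) => adj c (inr E : central G1)
  | inr (E, _), inl d => adj (inr E : central G1) d
  | inr (E, w), inr (F, z) => (E == F) && adj w z
  end.

Lemma cen_corona_adj_sym (G1 G2 : sgraph) :
  symmetric (@cen_corona_adj G1 G2).
Proof.
move=> [c|[E w]] [d|[F z]] //; rewrite /cen_corona_adj.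
- exact: (@adj_sym (central G1)).
- by rewrite eq_sym (@adj_sym G2).
Qed.

Lemma cen_corona_adj_irrefl (G1 G2 : sgraph) :
  irreflexive (@cen_corona_adj G1 G2).
Proof.
by move=> [c|[E w]]; rewrite /cen_corona_adj ?(@adj_irrefl (central G1)) ?(@adj_irrefl G2) ?andbF.
Qed.

Definition cen_corona (G1 G2 : sgraph) : sgraph :=
  SGraph (@cen_corona_adj_sym G1 G2) (@cen_corona_adj_irrefl G1 G2).

Definition adjacency_mx (R : rcfType) (G : sgraph) : 'M[R]_#|G| :=
  \matrix_(i, j) (adj (enum_val i) (enum_val j))%:R.

Definition degree_mx (R : rcfType) (G : sgraph) : 'M[R]_#|G| :=
  diag_mx (\row_i (degree (enum_val i))%:R).

Definition laplacian_mx (R : rcfType) (G : sgraph) : 'M[R]_#|G| :=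
  degree_mx R G - adjacency_mx R G.

(* The eigenvalues in R, repeated according to algebraic multiplicity, in
   nondecreasing order; there are n of them when M is symmetric. *)
Definition eigenvalues (R : rcfType) (n : nat) (M : 'M[R]_n) : seq R :=
  let p := char_poly M in
  sort <=%R (flatten [seq nseq (mup z p) z | z <- rootsR p]).

(* Both families are indexed from 1: lambda is nonincreasing, mu is
   nondecreasing. *)
Definition lambda (R : rcfType) (G : sgraph) (i : nat) : R :=
  nth 0 (rev (eigenvalues (adjacency_mx R G))) i.-1.

Definition mu (R : rcfType) (G : sgraph) (i : nat) : R :=
  nth 0 (eigenvalues (laplacian_mx R G)) i.-1.

Arguments lambda {R} G i.
Arguments mu {R} G i.

(* Needed as ('X - 2)^(m1 - n1) has a negative exponent when m1 < n1. *)
Notation ratfun p := (@FracField.tofrac _ p).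

(* Main.v *)
Require Import Defs.
From mathcomp Require Import all_boot all_order all_algebra.
From mathcomp Require Import polyrcf complex spectral perm ring.

Set Implicit Arguments.
Unset Strict Implicit.
Unset Printing Implicit Defensive.

Import Order.TTheory GRing.Theory Num.Theory.
Local Open Scope ring_scope.

(** The characteristic matrix 'X I - L of the corona is split into the rows of
    the vertices of G1 and the rows of all other vertices (subdivision vertices
    and copies of G2).  Write k = 'X - 2 and let D be the block of the other
    vertices and C the block below the vertices of G1: column v of C is the
    indicator of the edges at v, constant along each copy of G2.  The rows of
    k I - L(G2) sum to k, hence D C = k C.  This explicit relation makes a Schur
    complement available inside the polynomial ring, with no inversion of D
    ([det_block_dr]):

      det ('X I - L) k^n1 = det (k A - B C) det D,

    where det D = k^m1 prod_j (k - mu_j)^m1 because D is block diagonal.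

    The incidence matrix of an r1-regular graph multiplied by its transpose is
    r1 I + A(G1) ([sum_incidence]), so that k A - B C = a I - b A(G1) + k J with
    J the all-ones matrix and with a, b polynomials.  The all-ones vector is an
    eigenvector of a I - b A(G1) for c = a - b r1, and the rank-one update k J
    only replaces this factor c of the determinant by c + k n1
    ([det_add_const]).  The other factors of det (a I - b A(G1)) are the
    a - b lambda_i with i >= 2, since the largest eigenvalue lambda_1 of a
    regular graph is its degree ([lambda_regular1]) and since the symmetric
    matrix A(G1) has all its eigenvalues in the real closed field
    ([char_poly_eigenvalues], [det_pencil]).  Dividing by k^n1 in the field of
    fractions gives the formula, also when m1 < n1. *)

(** * Eigenvalues of real symmetric matrices *)

Lemma char_poly_conj (F : comUnitRingType) n (A P : 'M[F]_n) :
  P \in unitmx -> char_poly (invmx P *m A *m P) = char_poly A.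
Proof.
move=> Pu; rewrite /char_poly.
have PP : map_mx polyC (invmx P) *m map_mx polyC P = 1%:M.
  by rewrite -map_mxM mulVmx // map_mx1.
have -> : char_poly_mx (invmx P *m A *m P) =
    map_mx polyC (invmx P) *m char_poly_mx A *m map_mx polyC P.
  rewrite /char_poly_mx !map_mxM mulmxBr mulmxBl; congr (_ - _).
  by rewrite scalar_mxC -mulmxA PP mulmx1.
by rewrite det_mulmx det_mulmx mulrAC -det_mulmx PP det1 mul1r.
Qed.

(** Over the complex extension R[i] a real symmetric matrix is Hermitian, hence
    diagonalizable with real eigenvalues. *)
Lemma char_poly_sym_split (R : rcfType) n (A : 'M[R]_n) :
  A^T = A -> exists s : seq R, char_poly A = \prod_(z <- s) ('X - z%:P).
Proof.
move=> symA; pose Ac := map_mx (real_complex R) A.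
have realA : Ac \is a realmx.
  by apply/mxOverP=> i j; rewrite mxE; apply/complex_realP; exists (A i j).
have hermA : Ac \is hermsymmx.
  apply: realsym_hermsym => //; apply/is_hermitianmxP.
  by rewrite expr0 scale1r map_mx_id // /Ac map_trmx symA.
have /orthomx_spectralP specA := hermitian_normalmx hermA.
have /mxOverP realD := hermitian_spectral_diag_real hermA.
set D := spectral_diag Ac in specA realD.
exists [seq complex.Re (D 0 i) | i <- enum 'I_n].
apply: (@map_poly_inj _ _ (real_complex R)).
rewrite big_map map_prod_XsubC map_char_poly -/Ac specA.
rewrite char_poly_conj ?spectral_unit // char_poly_trig ?diag_mx_is_trig //.
rewrite big_enum; apply: eq_bigr => i _.
by rewrite mxE eqxx mulr1n /= RRe_real.
Qed.

Lemma char_poly_eigenvalues (R : rcfType) n (A : 'M[R]_n) :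
  A^T = A -> char_poly A = \prod_(z <- eigenvalues A) ('X - z%:P).
Proof.
move=> /char_poly_sym_split[s defA].
have nzA : char_poly A != 0 by rewrite monic_neq0 ?char_poly_monic.
rewrite defA; apply/perm_big; rewrite /eigenvalues perm_sym perm_sort.
apply/allP => x _ /=; apply/eqP; rewrite -[RHS]mu_prod_XsubC -defA.
rewrite count_flatten -map_comp.
rewrite sumnE big_map.
have [xr|xnr] := boolP (x \in rootsR (char_poly A)).
  rewrite (bigD1_seq x) ?uniq_roots //= count_nseq /= eqxx mul1n big1 ?addn0 //.
  by move=> y yx; rewrite count_nseq /= (negPf yx).
rewrite big1_seq ?mupNroot //.
  by have /(_ x) := roots_on_rootsR nzA; rewrite in_itv /= => ->.
move=> y /= yr; rewrite count_nseq /=.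
by case: eqP => // yx; rewrite -yx yr in xnr.
Qed.

Lemma size_eigenvalues (R : rcfType) n (A : 'M[R]_n) :
  A^T = A -> size (eigenvalues A) = n.
Proof.
move=> /char_poly_eigenvalues/(congr1 (fun p : {poly R} => size p)).
by rewrite size_char_poly size_prod_XsubC => -[].
Qed.

(** Homogenized form of the factorization of the characteristic polynomial: the
    determinant is b^n times the value of [char_poly A] at a / b. *)
Lemma det_pencil_field (F : fieldType) n (A : 'M[F]_n) (s : seq F) (a b : F) :
  b != 0 -> char_poly A = \prod_(z <- s) ('X - z%:P) ->
  \det (a%:M - b *: A) = \prod_(z <- s) (a - b * z).
Proof.
move=> b0 defA.
have sz : size s = n.
  have /(congr1 (fun p : {poly F} => size p)) := defA.
  by rewrite size_char_poly size_prod_XsubC => -[].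
have -> : a%:M - b *: A = b *: ((a / b)%:M - A).
  by rewrite scalerBr scale_scalar_mx mulrC divfK.
have -> : (a / b)%:M - A = map_mx (horner_eval (a / b)) (char_poly_mx A).
  apply/matrixP => i j; rewrite !mxE /horner_eval hornerD hornerN hornerC.
  by rewrite hornerMn hornerX.
rewrite detZ det_map_mx -/(char_poly A) defA /= /horner_eval horner_prod.
have -> : b ^+ n = \prod_(z <- s) b.
  by rewrite big_const_seq count_predT sz iter_mulr_1.
rewrite -big_split /=.
by apply: eq_bigr => z _; rewrite !hornerE mulrBr mulrC divfK.
Qed.

(** The previous lemma in the field of fractions of the polynomial ring. *)
Lemma det_pencil (F : fieldType) n (A : 'M[F]_n) (s : seq F) (p q : {poly F}) :
  q != 0 -> char_poly A = \prod_(z <- s) ('X - z%:P) ->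
  \det (p%:M - q *: map_mx polyC A) = \prod_(z <- s) (p - q * z%:P).
Proof.
move=> q0 defA; apply/eqP; rewrite -tofrac_eq; apply/eqP.
rewrite -det_map_mx rmorph_prod /= map_mxB map_scalar_mx map_mxZ -map_mx_comp.
rewrite (@det_pencil_field _ _ _ [seq (ratfun z%:P) | z <- s]) ?tofrac_eq0 //.
  by rewrite big_map; apply: eq_bigr => z _; rewrite rmorphB rmorphM.
by rewrite -map_char_poly defA map_prod_XsubC big_map.
Qed.

(** * Determinants of block matrices *)

(** A Schur complement without inverses: the relation [D *m C = s *: C] plays
    the role of D^-1 C = s^-1 C.  It clears the lower left block after
    multiplication on the right by the block matrix with rows (s, 0) and
    (- C, 1). *)
Lemma det_block_dr (P : comNzRingType) m n (A : 'M[P]_m) (B : 'M_(m, n))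
    (C : 'M_(n, m)) (D : 'M_n) (s : P) :
  D *m C = s *: C ->
  \det (block_mx A B C D) * s ^+ m = \det (s *: A - B *m C) * \det D.
Proof.
move=> DC.
have: block_mx A B C D *m block_mx s%:M 0 (- C) 1%:M =
      block_mx (s *: A - B *m C) B 0 D.
  rewrite mulmx_block !mulmx0 !mulmx1 !add0r !mul_mx_scalar !mulmxN DC.
  by rewrite subrr.
move/(congr1 (fun M => \det M)).
by rewrite det_mulmx det_lblock det_ublock det1 det_scalar mulr1.
Qed.

(** The mirror image of [det_block_dr], eliminating the upper right block. *)
Lemma det_block_ul (P : comNzRingType) m n (A : 'M[P]_m) (B : 'M_(m, n))
    (C : 'M_(n, m)) (D : 'M_n) (s : P) :
  A *m B = s *: B ->
  \det (block_mx A B C D) * s ^+ n = \det A * \det (s *: D - C *m B).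
Proof.
move=> AB.
have: block_mx A B C D *m block_mx 1%:M (- B) 0 s%:M =
      block_mx A 0 C (s *: D - C *m B).
  rewrite mulmx_block !mulmx0 !mulmx1 !addr0 !mul_mx_scalar !mulmxN AB.
  by rewrite addNr [in X in block_mx _ _ _ X]addrC.
move/(congr1 (fun M => \det M)).
by rewrite det_mulmx det_lblock det_ublock det1 det_scalar mul1r.
Qed.

(** Matrix determinant lemma for the all-ones direction: if the rows of M sum to
    c, adding t to every entry replaces the factor c of the determinant by
    c + t n. *)
Lemma det_add_const (P : comNzRingType) n (M : 'M[P]_n) (c t : P) :
  M *m const_mx 1 = c *: (const_mx 1 : 'cV_n) ->
  \det (M + const_mx t) * c = \det M * (c + t *+ n).
Proof.
move=> Mc; pose u : 'cV[P]_n := const_mx (- t); pose v : 'rV[P]_n := const_mx 1.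
have ut : u = - t *: const_mx 1.
  by apply/matrixP => i j; rewrite !mxE mulr1.
(* Both determinants are Schur complements of the matrix M bordered by a row of
   ones and a column of -t, with respect to either diagonal block. *)
have <- : \det (block_mx M u v 1%:M) = \det (M + const_mx t).
  have := @det_block_dr P n 1 M u v 1%:M 1.
  rewrite mul1mx scale1r => /(_ erefl).
  rewrite expr1n mulr1 scale1r det1 mulr1 => ->; congr (\det (_ + _)).
  apply/matrixP => i j; rewrite !mxE big_ord1 !mxE; ring.
have Mu : M *m u = c *: u by rewrite ut -scalemxAr Mc !scalerA mulrC.
have := @det_block_ul P n 1 M u v 1%:M c Mu; rewrite expr1 => ->.
rewrite det_mx11; congr (_ * _); rewrite !mxE eqxx mulr1; congr (_ + _).
under eq_bigr do rewrite !mxE mul1r.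
by rewrite sumr_const card_ord mulNrn opprK.
Qed.

(** * Matrices indexed by finite types *)

(** The matrix of a family f indexed by finite types, with rows and columns
    numbered by [enum_val]; the graph matrices are numbered in the same way. *)
Definition fmx (P : Type) (T U : finType) (f : T -> U -> P) : 'M_(#|T|, #|U|) :=
  \matrix_(i, j) f (enum_val i) (enum_val j).

Lemma mul_fmx (P : pzSemiRingType) (T U V : finType) (f : T -> U -> P)
    (g : U -> V -> P) :
  fmx f *m fmx g = fmx (fun x z => \sum_y f x y * g y z).
Proof.
apply/matrixP => i j; rewrite !mxE.
rewrite [RHS](reindex (@enum_val U predT)) /=; last exact/onW_bij/enum_val_bij.
by apply: eq_bigr => k _; rewrite !mxE.
Qed.

Lemma eq_fmx (P : Type) (T U : finType) (f g : T -> U -> P) :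
  f =2 g -> fmx f = fmx g.
Proof. by move=> fg; apply/matrixP => i j; rewrite !mxE. Qed.

Lemma det_reindex (P : comNzRingType) (T : finType) n m (h : 'I_n -> T)
    (e : 'I_m -> T) (f : T -> T -> P) :
  bijective h -> bijective e ->
  \det (\matrix_(i, j) f (h i) (h j)) = \det (\matrix_(i, j) f (e i) (e j)).
Proof.
move=> h_bij e_bij; have [h' hK h'K] := h_bij.
have nm : n = m.
  by rewrite -[n]card_ord -[m]card_ord (bij_eq_card h_bij) (bij_eq_card e_bij).
case: _ / nm e e_bij => e e_bij.
have k_inj : injective (h' \o e).
  by apply: inj_comp (bij_inj e_bij); exact: can_inj h'K.
pose s := perm k_inj.
have -> : \matrix_(i, j) f (e i) (e j) =
   row_perm s (col_perm s (\matrix_(i, j) f (h i) (h j))).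
  by apply/matrixP => i j; rewrite !mxE !permE /= !h'K.
rewrite row_permE col_permE !det_mulmx !det_perm odd_permV.
by rewrite mulrCA -signr_addb addbb mulr1.
Qed.

Lemma det_fmx_bij (P : comNzRingType) (S T : finType) (h : S -> T)
    (f : T -> T -> P) :
  bijective h -> \det (fmx f) = \det (fmx (fun x y => f (h x) (h y))).
Proof.
move=> h_bij; rewrite /fmx.
exact: (@det_reindex P T _ _ _ (h \o enum_val) _ (enum_val_bij T)
          (bij_comp h_bij (enum_val_bij S))).
Qed.

Lemma det_fmx_sum (P : comNzRingType) (S T : finType) (f : S + T -> S + T -> P) :
  \det (fmx f) =
  \det (block_mx (fmx (fun x y => f (inl x) (inl y)))
                 (fmx (fun x y => f (inl x) (inr y)))
                 (fmx (fun x y => f (inr x) (inl y)))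
                 (fmx (fun x y => f (inr x) (inr y)))).
Proof.
pose h (i : 'I_(#|S| + #|T|)) : S + T :=
  match split i with inl a => inl (enum_val a) | inr b => inr (enum_val b) end.
pose h' (x : S + T) : 'I_(#|S| + #|T|) :=
  match x with inl a => lshift _ (enum_rank a) | inr b => rshift _ (enum_rank b)
  end.
have h_bij : bijective h.
  exists h' => [i|[a|b]]; rewrite /h /h'.
  - by case: splitP => j ij; apply/val_inj; rewrite /= enum_valK.
  - by rewrite (unsplitK (inl _)) enum_rankK.
  - by rewrite (unsplitK (inr _)) enum_rankK.
rewrite -[LHS](@det_reindex P _ _ _ _ _ f h_bij (enum_val_bij (S + T)%type)).
congr (\det _); apply/matrixP => i j; rewrite /h !mxE.
by case: splitP => a _; rewrite !mxE; case: splitP => b _; rewrite !mxE.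
Qed.

Lemma det_fmx_prod_ord (P : comNzRingType) n (T : finType) (f : T -> T -> P) :
  \det (fmx (fun x y : 'I_n * T => (x.1 == y.1)%:R * f x.2 y.2)) =
  \det (fmx f) ^+ n.
Proof.
elim: n => [|n IHn].
  have det0 k (M : 'M[P]_k) : k = 0%N -> \det M = 1.
    by move=> k0; subst k; apply: det_mx00.
  by rewrite det0 // card_prod card_ord.
pose h (x : T + 'I_n * T) : 'I_n.+1 * T :=
  match x with inl t => (ord0, t) | inr (i, t) => (lift ord0 i, t) end.
pose h' (x : 'I_n.+1 * T) : T + 'I_n * T :=
  if unlift ord0 x.1 is Some i then inr (i, x.2) else inl x.2.
have h_bij : bijective h.
  exists h' => [[t|[i t]]|[i t]]; rewrite /h /h' /= ?unlift_none ?liftK //.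
  by case: unliftP => [j ->|->].
rewrite (det_fmx_bij _ h_bij) det_fmx_sum exprS -IHn.
have -> : fmx (fun (t : T) (y : 'I_n * T) =>
    ((h (inl t)).1 == (h (inr y)).1)%:R * f (h (inl t)).2 (h (inr y)).2) = 0.
  apply/matrixP => i j; rewrite !mxE; case: (enum_val j) => k t; rewrite /h /=.
  by rewrite mul0r.
rewrite det_lblock; congr (_ * _); congr (\det _); apply: eq_fmx.
  by move=> t u; rewrite /h /= mul1r.
by move=> [i t] [j u]; rewrite /h /= (inj_eq lift_inj).
Qed.

(** The determinant of a block diagonal matrix made of #|S| copies of f. *)
Lemma det_fmx_prod (P : comNzRingType) (S T : finType) (f : T -> T -> P) :
  \det (fmx (fun x y : S * T => (x.1 == y.1)%:R * f x.2 y.2)) =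
  \det (fmx f) ^+ #|S|.
Proof.
rewrite -det_fmx_prod_ord.
pose h (x : 'I_#|S| * T) : S * T := (enum_val x.1, x.2).
have h_bij : bijective h.
  exists (fun x => (enum_rank x.1, x.2)) => [[i t]|[s t]].
    by rewrite /h /= enum_valK.
  by rewrite /h /= enum_rankK.
rewrite (det_fmx_bij _ h_bij); congr (\det _).
apply: eq_fmx => x y; rewrite /h /=.
by rewrite (inj_eq enum_val_inj).
Qed.

(** * Edges, incidence and degrees *)

Lemma edgesP (G : sgraph) (E : {set G}) :
  reflect (exists u v : G, adj u v /\ E = [set u; v]) (E \in edges G).
Proof.
apply: (iffP imsetP) => [[[u v]]|[u [v [uv ->]]]].
  by rewrite inE /= => uv ->; exists u, v.
by exists (u, v); rewrite ?inE.
Qed.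

Lemma card_edge_pred (G : sgraph) (Q : pred {set G}) :
  #|[set E : edge G | Q (val E)]| = #|[set E in edges G | Q E]|.
Proof.
rewrite -(card_imset _ val_inj); apply: eq_card => E; rewrite !inE.
apply/imsetP/andP => [[F]|[EG QE]].
  by rewrite inE => QF ->; split=> //; exact: valP F.
by exists (Sub E EG); rewrite ?inE SubK.
Qed.

Lemma degreeE (G : sgraph) (u : G) : degree u = (\sum_(v : G) adj u v)%N.
Proof.
by rewrite /degree -sum1dep_card big_mkcond; apply: eq_bigr => v _; case: adj.
Qed.

Lemma sum_mem_edge (G : sgraph) (E : edge G) : (\sum_(v : G) (v \in val E))%N = 2.
Proof.
have /edgesP[u [v [uv EE]]] := valP E.
have <- : #|val E| = 2.
  by rewrite EE cards2; case: eqP uv => // ->; rewrite adj_irrefl.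
by rewrite -sum1_card [RHS]big_mkcond; apply: eq_bigr => w _; case: (w \in _).
Qed.

(** The entries of the incidence matrix multiplied by its transpose: two distinct
    vertices share exactly one edge if they are adjacent and none otherwise. *)
Lemma sum_incidence (G : sgraph) (u v : G) :
  (\sum_(E : edge G) ((u \in val E) && (v \in val E)) =
   (u == v) * degree u + adj u v)%N.
Proof.
transitivity #|[set E : edge G | (u \in val E) && (v \in val E)]|.
  by rewrite -sum1dep_card [RHS]big_mkcond; apply: eq_bigr => E _; case: ifP.
rewrite (card_edge_pred (fun E => (u \in E) && (v \in E))).
have [<-|nuv] := eqVneq u v.
  rewrite adj_irrefl addn0 mul1n /degree.
  rewrite -[RHS](@card_in_imset _ _ (fun w : G => [set u; w])); last first.
    move=> w w'; rewrite !inE => uw uw' /setP/(_ w); rewrite !inE eqxx orbT.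
    by case: eqP uw => [->|_ _]; rewrite ?adj_irrefl // => /esym/eqP.
  apply: eq_card => E; rewrite !inE andbb; apply/andP/imsetP.
    move=> [/edgesP[a [b [ab ->]]]]; rewrite !inE => /orP[] /eqP ->.
      by exists b; rewrite ?inE.
    by exists a; rewrite ?inE 1?adj_sym // setUC.
  move=> [w]; rewrite inE => uw ->; split; last by rewrite !inE eqxx.
  by apply/edgesP; exists u, w.
rewrite mul0n add0n; have [uv|nauv] := boolP (adj u v).
  rewrite -[RHS](cards1 [set u; v]); apply: eq_card => E; rewrite !inE.
  apply/and3P/eqP => [[/edgesP[a [b [ab ->]]]]|->]; last first.
    by rewrite !inE !eqxx orbT; split=> //; apply/edgesP; exists u, v.
  rewrite !inE => /orP[] /eqP eu /orP[] /eqP ev; move: nuv;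
    rewrite eu ev ?eqxx // => _.
  exact: setUC.
apply: eq_card0 => E; rewrite !inE; apply/and3P => -[/edgesP[a [b [ab ->]]]].
rewrite !inE => /orP[] /eqP eu /orP[] /eqP ev; move: nuv nauv;
  rewrite eu ev ?eqxx // => _.
  by rewrite ab.
by rewrite adj_sym ab.
Qed.

Lemma sum_incident (G : sgraph) (u : G) :
  (\sum_(E : edge G) (u \in val E))%N = degree u.
Proof.
have := sum_incidence u u; rewrite eqxx mul1n adj_irrefl addn0 => <-.
by apply: eq_bigr => E _; rewrite andbb.
Qed.

Section Degrees.
Variables G1 G2 : sgraph.
Local Notation H := (cen_corona G1 G2).

(** A vertex of G1 is adjacent in C(G1) to its non-neighbours in G1 and to the
    subdivision vertices of its edges, that is #|G1| - 1 vertices in all, and to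
    one copy of G2 for each of its edges. *)
Lemma degree_corona_vertex (u : G1) :
  (degree (inl (inl u) : H)).+1 = (#|G1| + #|G2| * degree u)%N.
Proof.
rewrite degreeE !big_sumType /= sum_incident.
rewrite [X in (_ + X)%N](_ : _ =
    \sum_(E : edge G1) \sum_(w : G2) (u \in val E))%N; last first.
  by rewrite pair_bigA; apply: eq_bigr => -[].
under [X in (_ + X)%N]eq_bigr do rewrite sum_nat_const.
rewrite -big_distrr /= sum_incident -addSn; congr (_ + _)%N.
(* A vertex other than u is counted once: by its non-adjacency to u in the first
   sum, or by its adjacency in the degree of u. *)
rewrite degreeE -big_split /= -sum1_card [RHS](bigD1 u) //=.
rewrite (bigD1 u) //= eqxx adj_irrefl add0n add1n; congr _.+1.
by apply: eq_bigr => v; rewrite eq_sym => /negPf ->; case: adj.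
Qed.

Lemma degree_corona_edge (E : edge G1) : degree (inl (inr E) : H) = 2.
Proof.
rewrite degreeE !big_sumType /= sum_mem_edge !big1 // => -[F w] _ //=.
Qed.

Lemma degree_corona_copy (E : edge G1) (w : G2) :
  degree (inr (E, w) : H) = (2 + degree w)%N.
Proof.
rewrite !degreeE !big_sumType /= sum_mem_edge [X in (2 + X + _)%N]big1 // addn0.
rewrite [X in (_ + X)%N](_ : _ =
    \sum_(F : edge G1) \sum_(z : G2) ((E == F) && adj w z))%N; last first.
  by rewrite pair_bigA; apply: eq_bigr => -[].
rewrite (bigD1 E) //= [X in (_ + (_ + X))%N]big1 ?addn0; last first.
  by move=> F; rewrite eq_sym => /negPf ->; rewrite big1.
by congr addn; apply: eq_bigr => z _; rewrite eqxx.
Qed.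
End Degrees.

(** * Spectra of graphs *)

Lemma adjacency_mx_sym (R : rcfType) (G : sgraph) :
  (adjacency_mx R G)^T = adjacency_mx R G.
Proof. by apply/matrixP => i j; rewrite !mxE adj_sym. Qed.

Lemma laplacian_mx_sym (R : rcfType) (G : sgraph) :
  (laplacian_mx R G)^T = laplacian_mx R G.
Proof.
by rewrite /laplacian_mx linearB /= adjacency_mx_sym /degree_mx tr_diag_mx.
Qed.

Lemma char_poly_laplacianE (R : rcfType) (G : sgraph) :
  char_poly (laplacian_mx R G) =
  \det (fmx (fun x y : G =>
    (x == y)%:R * ('X - (degree x)%:R) + (adj x y)%:R : {poly R})).
Proof.
congr (\det _); apply/matrixP => i j; rewrite !mxE (inj_eq enum_val_inj).
rewrite !raddfB raddfMn /= !polyCMn; case: eqVneq => [->|_] /=.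
  ring.
ring.
Qed.

Lemma sum_adj (R : pzSemiRingType) (G : sgraph) (u : G) :
  \sum_(v : G) (adj u v)%:R = (degree u)%:R :> R.
Proof. by rewrite degreeE natr_sum. Qed.

Lemma sum_enum_val (V : nmodType) (T : finType) (f : T -> V) :
  \sum_(i < #|T|) f (enum_val i) = \sum_x f x.
Proof.
by rewrite [RHS](reindex (@enum_val T predT)) //=; apply/onW_bij/enum_val_bij.
Qed.

Lemma regular_root (R : rcfType) (G : sgraph) (r : nat) :
  (0 < #|G|)%N -> regular G r -> root (char_poly (adjacency_mx R G)) r%:R.
Proof.
move=> G0 regG; rewrite -eigenvalue_root_char; apply/eigenvalueP.
exists (const_mx 1).
  apply/rowP => j; rewrite !mxE mulr1.
  under eq_bigr do rewrite !mxE mul1r adj_sym.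
  by rewrite (sum_enum_val (fun v : G => (adj (enum_val j) v)%:R)) sum_adj regG.
apply/eqP => /rowP/(_ (Ordinal G0)); rewrite !mxE; exact/eqP/oner_neq0.
Qed.

(** At an entry of largest absolute value of an eigenvector for z, the
    eigenvalue equation bounds |z| by the degree. *)
Lemma regular_root_le (R : rcfType) (G : sgraph) (r : nat) (z : R) :
  regular G r -> root (char_poly (adjacency_mx R G)) z -> z <= r%:R.
Proof.
move=> regG; rewrite -eigenvalue_root_char => /eigenvalueP[v vA v0].
have /rV0Pn[i0 _] := v0.
pose i := [arg max_(i > i0) `|v 0 i|]%O.
have maxi j : `|v 0 j| <= `|v 0 i|.
  by rewrite /i; case: arg_maxP => // k _ kmax; apply: kmax.
have vi_gt0 : 0 < `|v 0 i|.
  rewrite lt_neqAle normr_ge0 andbT eq_sym; apply: contraNneq v0 => vi.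
  apply/eqP/rowP => j; apply/eqP; rewrite mxE -normr_le0 -vi; exact: maxi.
rewrite (le_trans (ler_norm z)) // -(ler_pM2r vi_gt0) -normrM.
have /rowP/(_ i) := vA; rewrite !mxE => <-.
rewrite (le_trans (ler_norm_sum _ _ _)) // -(regG (enum_val i)) -sum_adj.
rewrite -(sum_enum_val (fun v : G => (adj (enum_val i) v)%:R)) mulr_suml.
apply: ler_sum => j _; rewrite mxE normrM mulrC adj_sym normr_nat.
by rewrite ler_wpM2l ?ler0n.
Qed.

Lemma lambda_regular1 (R : rcfType) (G : sgraph) (r : nat) :
  (0 < #|G|)%N -> regular G r -> lambda G 1 = r%:R :> R.
Proof.
move=> G0 regG; rewrite /lambda /=.
set s := eigenvalues _.
have defA : char_poly _ = \prod_(z <- s) _ :=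
  char_poly_eigenvalues (adjacency_mx_sym R G).
have rs : r%:R \in rev s.
  by rewrite mem_rev -root_prod_XsubC -defA regular_root.
have s0 : (0 < size (rev s))%N by case: (rev s) rs.
apply/le_anti/andP; split.
  apply: (regular_root_le regG); rewrite defA root_prod_XsubC -mem_rev.
  exact: mem_nth.
have: sorted >=%R (rev s) by rewrite rev_sorted; apply: sort_le_sorted.
case: (rev s) rs => [//|x t] /=; rewrite inE => /orP[/eqP -> //|rt].
rewrite path_sortedE; last by move=> a b c ab bc; exact: le_trans bc ab.
by case/andP => /allP/(_ _ rt).
Qed.

(** The first eigenvalue is set apart, as it needs a separate treatment. *)
Lemma prod_lambda (R : rcfType) (G : sgraph) (V : comPzSemiRingType)
    (F : R -> V) :
  (0 < #|G|)%N ->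
  \prod_(z <- eigenvalues (adjacency_mx R G)) F z =
  F (lambda G 1) * \prod_(2 <= i < #|G|.+1) F (lambda G i).
Proof.
set s := eigenvalues _ => G0.
have ps : perm_eq (rev s) s by rewrite perm_rev.
rewrite -(perm_big _ ps) /= (big_nth 0) size_rev.
rewrite size_eigenvalues ?adjacency_mx_sym //.
transitivity (\prod_(1 <= i < #|G|.+1) F (lambda G i)); last by rewrite big_ltn.
by rewrite big_add1.
Qed.

Lemma prod_mu (R : rcfType) (G : sgraph) (V : comPzSemiRingType)
    (F : R -> V) :
  \prod_(z <- eigenvalues (laplacian_mx R G)) F z =
  \prod_(1 <= i < #|G|.+1) F (mu G i).
Proof.
rewrite (big_nth 0) size_eigenvalues ?laplacian_mx_sym //.
by rewrite big_add1.
Qed.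

(** * The Laplacian of the corona *)

(** The vertices of the corona with the vertices of G1 set apart from the
    subdivision vertices and the copies of G2. *)
Definition regroup (G1 G2 : sgraph) (x : G1 + (edge G1 + edge G1 * G2)) :
    cen_corona G1 G2 :=
  match x with
  | inl u => inl (inl u)
  | inr (inl E) => inl (inr E)
  | inr (inr p) => inr p
  end.

Lemma regroup_bij (G1 G2 : sgraph) : bijective (@regroup G1 G2).
Proof.
exists (fun y : cen_corona G1 G2 => match y with
  | inl (inl u) => inl u | inl (inr E) => inr (inl E) | inr p => inr (inr p)
  end); first by case=> [|[]].
by case=> [[]|].
Qed.

Section Corona.

Variables (R : rcfType) (G1 G2 : sgraph) (r : nat).
Hypothesis regG1 : regular G1 r.
Let n1 : {poly R} := #|G1|%:R.
Let n2 : {poly R} := #|G2|%:R.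
Let k : {poly R} := 'X - 2.
Let a : {poly R} := k * ('X - n1 - n2 * r%:R) - (1 + n2) * r%:R.
Let b : {poly R} := k + 1 + n2.
(* A, B, C, D are the blocks, along the decomposition of [regroup], of the
   characteristic matrix of the Laplacian, whose entries are given by f. *)
Let H := cen_corona G1 G2.
Let f (x y : H) : {poly R} := (x == y)%:R * ('X - (degree x)%:R) + (adj x y)%:R.
Let W : finType := (edge G1 + edge G1 * G2)%type.
Let A := fmx (fun u v : G1 => f (inl (inl u)) (inl (inl v))).
Let B := fmx (fun (u : G1) (y : W) => f (inl (inl u)) (regroup (inr y))).
Let C := fmx (fun (x : W) (v : G1) => f (regroup (inr x)) (inl (inl v))).
Let D := fmx (fun x y : W => f (regroup (inr x)) (regroup (inr y))).

Let rowsum_copy (w : G2) :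
  \sum_(z : G2) ((w == z)%:R * (k - (degree w)%:R) + (adj w z)%:R) = k.
Proof.
rewrite big_split /= -mulr_suml sum_adj (bigD1 w) //= eqxx big1 ?addr0.
  by rewrite mul1r subrK.
by move=> z; rewrite eq_sym => /negPf->.
Qed.

Let f_copy E F w z :
  f (inr (E, w)) (inr (F, z)) =
  (E == F)%:R * ((w == z)%:R * (k - (degree w)%:R) + (adj w z)%:R).
Proof.
rewrite /f degree_corona_copy /= /k natrD.
have -> : (@inr (central G1) _ (E, w) == inr (F, z)) =
          (E == F) && (w == z) by [].
case: (E == F); case: (w == z); case: (adj w z) => /=; ring.
Qed.

Let f_edge (E F : edge G1) :
  f (inl (inr E)) (inl (inr F)) = (E == F)%:R * k.
Proof.
rewrite /f degree_corona_edge /= addr0 /k.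
by have -> : (@inl (central G1) (edge G1 * G2) (inr E) == inl (inr F)) =
             (E == F) by [].
Qed.

Let f_vertex (u v : G1) :
  f (inl (inl u)) (inl (inl v)) =
  (u == v)%:R * ('X - n1 - n2 * r%:R) + 1 - (adj u v)%:R.
Proof.
have duE : (degree (inl (inl u) : H))%:R = n1 + n2 * r%:R - 1 :> {poly R}.
  rewrite -(regG1 u) -natrM -natrD -degree_corona_vertex -natr1; ring.
rewrite /f duE /=.
have -> : (@inl (central G1) (edge G1 * G2) (inl u) == inl (inl v)) =
          (u == v) by [].
have [<-|_] := eqVneq u v; first by rewrite adj_irrefl /=; ring.
by case: (adj u v) => /=; ring.
Qed.

Let DC : D *m C = k *: C.
Proof.
rewrite mul_fmx; apply/matrixP => i j; rewrite !mxE.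
move: (enum_val i) (enum_val j) => x v {i j}; rewrite big_sumType /=.
case: x => [E|[E w]] /=.
- rewrite (bigD1 E) //= f_edge eqxx mul1r !big1 ?addr0 //.
    by move=> [F z] _; rewrite /f /= addr0 mul0r mul0r.
  by move=> F; rewrite eq_sym f_edge => /negPf->; rewrite !mul0r.
- rewrite big1 ?add0r; last by move=> F _; rewrite /f /= addr0 mul0r mul0r.
  transitivity (\sum_(F : edge G1) \sum_(z : G2)
     (E == F)%:R * ((w == z)%:R * (k - (degree w)%:R) + (adj w z)%:R)
       * (v \in val F)%:R : {poly R}).
    rewrite pair_bigA; apply: eq_bigr => -[F z] _ /=.
    by rewrite f_copy; congr (_ * _); rewrite /f /= mul0r add0r.
  rewrite (bigD1 E) //= [X in _ + X]big1 ?addr0; last first.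
    move=> F; rewrite eq_sym => /negPf->; apply: big1 => z _.
    by rewrite !mul0r.
  rewrite -mulr_suml eqxx; under eq_bigr do rewrite mul1r.
  by rewrite rowsum_copy /f /= mul0r add0r.
Qed.

Let schur_vertices :
  k *: A - B *m C = a%:M - b *: map_mx polyC (adjacency_mx R G1) + const_mx k.
Proof.
rewrite mul_fmx; apply/matrixP => i j.
rewrite !mxE f_vertex.
have -> : (i == j) = (enum_val i == enum_val j) by rewrite (inj_eq enum_val_inj).
move: (enum_val i) (enum_val j) => u v {i j}.
have -> : \sum_(y : W) f (inl (inl u)) (regroup (inr y))
            * f (regroup (inr y)) (inl (inl v)) =
  (1 + n2) * ((u == v)%:R * r%:R + (adj u v)%:R).
  have /(congr1 (fun n : nat => n%:R : {poly R})) := sum_incidence u v.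
  rewrite natr_sum natrD natrM regG1 => <-.
  rewrite big_sumType /= mulrDl mul1r; congr (_ + _).
    apply: eq_bigr => E _; rewrite /f /= !mul0r !add0r.
    by rewrite -natrM mulnb.
  transitivity (\sum_(E : edge G1) \sum_(w : G2)
     ((u \in val E) && (v \in val E))%:R : {poly R}).
    rewrite pair_bigA; apply: eq_bigr => -[E w] _ /=.
    by rewrite /f /= !mul0r !add0r -natrM mulnb.
  rewrite mulr_sumr; apply: eq_bigr => E _.
  by rewrite sumr_const mulr_natl.
rewrite /a /b polyC_natr -mulr_natl; ring.
Qed.

Let detD :
  \det D = k ^+ #|edges G1| *
    (\prod_(1 <= j < #|G2|.+1) (k - (mu G2 j)%:P)) ^+ #|edges G1|.
Proof.
have card_edge : #|edge G1| = #|edges G1| by rewrite card_sig; apply: eq_card.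
rewrite det_fmx_sum /=.
rewrite [X in block_mx _ X](_ : _ = 0); last first.
  apply/matrixP => i j; rewrite !mxE; case: (enum_val j) => E w.
  by rewrite /f /= mul0r addr0.
rewrite det_lblock -card_edge; congr (_ * _).
  rewrite -det_scalar; congr (\det _); apply/matrixP => i j.
  by rewrite !mxE f_edge (inj_eq enum_val_inj) mulr_natl.
rewrite (eq_fmx (g := fun x y : edge G1 * G2 => (x.1 == y.1)%:R *
    ((x.2 == y.2)%:R * (k - (degree x.2)%:R) + (adj x.2 y.2)%:R))); last first.
  by move=> [E w] [F z]; rewrite f_copy.
rewrite (@det_fmx_prod _ _ _ (fun w z : G2 =>
    (w == z)%:R * (k - (degree w)%:R) + (adj w z)%:R)).
congr (_ ^+ _).
have := det_pencil k (oner_neq0 _)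
                   (char_poly_eigenvalues (laplacian_mx_sym R G2)).
under [RHS]eq_bigr do rewrite mul1r.
rewrite (prod_mu _ (fun z => k - z%:P)) => <-.
congr (\det _); apply/matrixP => i j; rewrite !mxE (inj_eq enum_val_inj).
rewrite mul1r raddfB raddfMn /= !polyC_natr.
case: eqVneq => [->|_] /=; ring.
Qed.

(** The polynomial form of the formula, with the factor k^n1 kept on the left
    instead of a possibly negative power of k on the right. *)
Lemma char_poly_laplacian_corona :
  (0 < #|G1|)%N ->
  char_poly (laplacian_mx R H) * k ^+ #|G1| =
  k ^+ #|edges G1|
  * (('X^2 - (n2 * r%:R + r%:R + 2) * 'X)
     * \prod_(1 <= j < #|G2|.+1) (k - (mu G2 j)%:P) ^+ #|edges G1|
     * \prod_(2 <= i < #|G1|.+1) (a - b * (lambda G1 i)%:P)).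
Proof.
move=> G1_gt0.
rewrite char_poly_laplacianE (det_fmx_bij _ (@regroup_bij G1 G2)) det_fmx_sum.
rewrite (det_block_dr _ _ DC) schur_vertices detD -prodrXl.
have b0 : b != 0.
  have -> : b = 'X - (1 - #|G2|%:R)%:P.
    by rewrite /b /k /n2 polyCB polyC_natr; ring.
  by rewrite polyXsubC_eq0.
have := det_pencil a b0 (char_poly_eigenvalues (adjacency_mx_sym R G1)).
rewrite (prod_lambda (fun z => a - b * z%:P)) //.
rewrite (lambda_regular1 _ G1_gt0 regG1).
(* M is a I - b A(G1), and c its factor for the eigenvalue r. *)
set M := _ - _; set c := a - _ => detM.
(* c is a quadratic polynomial with leading coefficient 1. *)
have c0 : c != 0.
  pose u : R := #|G1|%:R + #|G2|%:R * r%:R + r%:R.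
  pose w : R := 2 * (1 + #|G2|%:R) * r%:R.
  have -> : c = ('X - 2%:P) * ('X - u%:P) - w%:P.
    rewrite /c /a /b /k /n1 /n2 /u /w !(polyCD, polyCM, polyC_natr); ring.
  rewrite subr_eq0; apply/negP => /eqP/(congr1 (fun p : {poly R} => size p)).
  rewrite size_mul ?polyXsubC_eq0 // !size_XsubC size_polyC.
  by case: (w != 0).
have M1 : M *m const_mx 1 = c *: (const_mx 1 : 'cV_#|G1|).
  apply/colP => i; rewrite !mxE mulr1.
  under eq_bigr do rewrite !mxE mulr1 polyC_natr.
  rewrite big_split /= sumrN -mulr_sumr.
  rewrite (sum_enum_val (fun v => (adj (enum_val i) v)%:R)) sum_adj regG1.
  rewrite (bigD1 i) //= eqxx mulr1n big1 ?addr0 /c ?polyC_natr //.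
  by move=> j; rewrite eq_sym => /negPf->.
have := det_add_const k M1.
rewrite detM -(mulrA c) [c * _ in RHS]mulrC => /(mulIf c0) ->.
have -> : c + k *+ #|G1| = 'X^2 - (n2 * r%:R + r%:R + 2) * 'X.
  rewrite -[k *+ _]mulr_natl -/n1 /c /a /b /k polyC_natr.
  ring.
rewrite [LHS]mulrCA -(mulrA (\prod_(_ <= _ < _) _)).
by rewrite [in LHS](mulrC (\prod_(2 <= _ < _) _)).
Qed.
End Corona.

Theorem theorem5p6 (R : rcfType) (G1 G2 : sgraph) (r1 n1 m1 n2 : nat)
    (conn1 : connected G1) (conn2 : connected G2)
    (reg1 : regular G1 r1)
    (card_n1 : #|G1| = n1) (card_m1 : #|edges G1| = m1) (card_n2 : #|G2| = n2) :
  ratfun (char_poly (laplacian_mx R (cen_corona G1 G2))) =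
  ratfun ('X - 2%:P) ^ (m1%:Z - n1%:Z)
  * ratfun
     (('X^2 - (n2%:R * r1%:R + r1%:R + 2) *: 'X)
      (* each vertex in a copy of G2 has two extra neighbours: the ends of
         the edge carrying that copy *)
      * \prod_(1 <= j < n2.+1) ('X - (2 + mu G2 j)%:P) ^+ m1
      * \prod_(2 <= i < n1.+1)
          ('X^2 - (2 + n1%:R + n2%:R * r1%:R + lambda G1 i) *: 'X
           + (2 * n1%:R + n2%:R * r1%:R - r1%:R + lambda G1 i
              - n2%:R * lambda G1 i)%:P)).
Proof.
have k0 : ratfun ('X - 2%:P : {poly R}) != 0 by rewrite tofrac_eq0 polyXsubC_eq0.
have [G1_gt0 _] := conn1.
rewrite expfzDr // -exprnP -exprnN mulrAC; apply: (mulIf (expf_neq0 n1 k0)).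
rewrite divfK ?expf_neq0 // -!tofracXn -!tofracM; congr (ratfun _).
have := char_poly_laplacian_corona R G2 reg1 G1_gt0.
rewrite card_n1 card_m1 card_n2 polyC_natr => ->; congr (_ * (_ * _ * _)).
- by rewrite -mul_polyC !(polyCD, polyCM, polyC_natr).
- by apply: eq_bigr => j _; congr (_ ^+ _); rewrite polyCD polyC_natr; ring.
- apply: eq_bigr => i _.
  rewrite -mul_polyC !(polyCD, polyCN, polyCM, polyC_natr); ring.
Qed.
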